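(* Let $k \geq 4$ and let $G$ be an $SQSR(n, k, 0; k-1, k-2, k-3)$ graph. Then $$2k+3 \leq n \leq k^2 - 4.$$ Furthermore, $n = k^2-4$ if and only if $G$ is isomorphic to $G_2$, and $n = 2k+3$ if and only if $G$ is isomorphic to $G_1$.
   Context: All graphs are finite and simple. For a vertex $v$, $N(v)$ denotes its set of neighbours. A $QSR(n,k,a;c_1,\ldots,c_p)$ graph (quasi-strongly regular graph) is a $k$-regular graph on $n$ vertices such that any two adjacent vertices have exactly $a$ common neighbours and any two distinct non-adjacent vertices have exactly $c_i$ common neighbours for some $1 \le i \le p$. Its grade is the number of indices $i$ for which there actually exist two non-adjacent vertices with exactly $c_i$ common neighbours; it is proper if its grade is $p$. An $SQSR(n,k,a;c_1,\ldots,c_p)$ graph (strictly quasi-strongly regular) is a proper $QSR(n,k,a;c_1,\ldots,c_p)$ graph in which $a, c_1, \ldots, c_p$ are pairwise distinct. $G_1$ is the graph on vertex set $\{1,\ldots,11\}$ with edges $\{1,2\},\{1,3\},\{1,4\},\{1,5\},\{2,6\},\{3,6\},\{4,6\},\{2,7\},\{3,7\},\{3,8\},\{2,10\},\{4,11\},\{4,8\},\{5,8\},\{8,10\},\{5,9\},\{5,11\},\{6,9\},\{7,9\},\{7,11\},\{9,10\},\{10,11\}$ (it is an $SQSR(11,4,0;3,2,1)$ graph). $G_2$ is the graph on vertex set $\{1,\ldots,12\}$ with edges $\{1,3\},\{1,4\},\{1,5\},\{1,6\},\{2,3\},\{2,4\},\{2,5\},\{2,7\},\{6,7\},\{6,8\},\{3,8\},\{8,12\},\{8,11\},\{6,9\},\{4,9\},\{9,12\},\{9,10\},\{3,10\},\{5,10\},\{10,11\},\{7,11\},\{4,11\},\{7,12\},\{5,12\}$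 (it is an $SQSR(12,4,0;3,2,1)$ graph). *)

(* Defs.v *)
From mathcomp Require Import all_boot.

Set Implicit Arguments.
Unset Strict Implicit.
Unset Printing Implicit Defensive.

Record sgraph := SGraph {
  vertex :> finType;
  adj : rel vertex;
  adj_sym : symmetric adj;
  adj_irr : irreflexive adj }.

Definition nbr (G : sgraph) (x : G) : {set G} := [set y | adj x y].

(* The parameters c_1, ..., c_p are given as the sequence cs, with p = size cs. *)
Definition QSR (n k a : nat) (cs : seq nat) (G : sgraph) : Prop :=
  [/\ #|G| = n,
      forall x : G, #|nbr x| = k,
      forall x y : G, adj x y -> #|nbr x :&: nbr y| = a
    & forall x y : G, x != y -> ~~ adj x y -> #|nbr x :&: nbr y| \in cs].

Definition attained (G : sgraph) (c : nat) : bool :=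
  [exists x : G, exists y : G,
     [&& x != y, ~~ adj x y & #|nbr x :&: nbr y| == c]].

(* count ranges over positions of cs, hence over the indices i of the c_i. *)
Definition grade (cs : seq nat) (G : sgraph) : nat := count (attained G) cs.

Definition proper_QSR (n k a : nat) (cs : seq nat) (G : sgraph) : Prop :=
  QSR n k a cs G /\ grade cs G = size cs.

Definition SQSR (n k a : nat) (cs : seq nat) (G : sgraph) : Prop :=
  proper_QSR n k a cs G /\ uniq (a :: cs).

Definition isomorphic (G H : sgraph) : Prop :=
  exists2 f : G -> H, bijective f & forall x y : G, adj (f x) (f y) = adj x y.

(* The graph on {1, ..., m} with edge list E; the vertex labelled i.+1 is
   represented by i : 'I_m. Loops in E would be ignored. *)
Definition edge_rel (m : nat) (E : seq (nat * nat)) : rel 'I_m := fun i j =>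
  (i != j) && (((i.+1, j.+1) \in E) || ((j.+1, i.+1) \in E)).

Fact edge_rel_sym (m : nat) (E : seq (nat * nat)) : symmetric (@edge_rel m E).
Proof. by move=> i j; rewrite /edge_rel eq_sym orbC. Qed.

Fact edge_rel_irr (m : nat) (E : seq (nat * nat)) : irreflexive (@edge_rel m E).
Proof. by move=> i; rewrite /edge_rel eqxx. Qed.

Definition edge_graph (m : nat) (E : seq (nat * nat)) : sgraph :=
  SGraph (@edge_rel_sym m E) (@edge_rel_irr m E).

Definition G1 : sgraph := edge_graph 11
  [:: (1, 2); (1, 3); (1, 4); (1, 5); (2, 6); (3, 6); (4, 6); (2, 7); (3, 7);
      (3, 8); (2, 10); (4, 11); (4, 8); (5, 8); (8, 10); (5, 9); (5, 11);
      (6, 9); (7, 9); (7, 11); (9, 10); (10, 11)].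

Definition G2 : sgraph := edge_graph 12
  [:: (1, 3); (1, 4); (1, 5); (1, 6); (2, 3); (2, 4); (2, 5); (2, 7); (6, 7);
      (6, 8); (3, 8); (8, 12); (8, 11); (6, 9); (4, 9); (9, 12); (9, 10);
      (3, 10); (5, 10); (10, 11); (7, 11); (4, 11); (7, 12); (5, 12)].

(* Main.v *)
Require Import Defs.
From mathcomp Require Import all_boot zify.

Set Implicit Arguments.
Unset Strict Implicit.
Unset Printing Implicit Defensive.

(** Let x, y be non-adjacent with k - 1 common neighbours, and let d, e be the
    remaining neighbour of x, respectively of y.  A common neighbour of x and e
    cannot be adjacent to y, so it is d; hence k - 3 <= 1, that is k = 4, and d
    is adjacent to e.  Write N(x) = {a, b, c, d}, N(y) = {a, b, c, e},
    N(d) = {x, e, p, q} and N(e) = {y, d, r, s}.  A vertex outside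
    {x, y, a, b, c, d, e} shares a neighbour with x and one with y, and is not
    adjacent to both d and e, so it is one of the at most 6 other neighbours of
    a, b, c.  Hence 11 <= n <= 13, and the remaining adjacencies are enumerated:
    there is no solution for n = 13, and for n = 12 and n = 11 every solution is
    a labelling of G2, respectively G1. *)

(** * Adjacency matrices as bit sequences and the search over them *)

Definition amx {T : Type} (e : rel T) (s : seq T) : seq bitseq :=
  [seq [seq e v w | w <- s] | v <- s].

Definition meet (r1 r2 : bitseq) : bool := has (fun b => b.1 && b.2) (zip r1 r2).

Definition border (r : bitseq) (M : seq bitseq) : seq bitseq :=
  (false :: r) :: [seq p.1 :: p.2 | p <- zip r M].

(* A vertex that already has its 4 neighbours in the matrix must share one of
   them with every vertex that it is not adjacent to. *)
Definition admissible (M : seq bitseq) : bool :=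
  if all (fun r => count id r <= 4) M then
    all (fun r => all (fun p => if p.1 then ~~ meet r p.2
                                else (count id r == 4) ==> meet r p.2)
      (zip r M)) M
  else false.

Definition regular4 (M : seq bitseq) : bool := all (fun r => count id r == 4) M.

Fixpoint bitseqs (n : nat) : seq bitseq :=
  if n is m.+1 then [seq b :: t | b <- [:: true; false], t <- bitseqs m]
  else [:: [::]].

(** The new row runs over the [size M - 7] vertices placed after the core, then e and d with entries
    [f], then c, b, a, and finally y and x, which have no neighbour outside the core. *)
Definition extend (f : bitseq) (M : seq bitseq) : seq (seq bitseq) :=
  [seq M' <- [seq border (t ++ f ++ u ++ [:: false; false]) M
             | t <- bitseqs (size M - 7), u <- bitseqs 3] | admissible M'].

(** [foldr] consumes [fs] from its end, so the head of [fs] belongs to the outermost row, as in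
    [amx] of a list. *)
Definition grow (M : seq bitseq) (fs : seq bitseq) : seq (seq bitseq) :=
  foldr (fun f Ms => flatten [seq extend f N | N <- Ms]) [:: M] fs.

Definition label_rel (E : seq (nat * nat)) : rel nat :=
  fun i j => (i != j) && (((i, j) \in E) || ((j, i) \in E)).

(* The vertices e, d, c, b, a, y, x, in this order, carry the labels 6, ..., 0. *)
Definition core : seq bitseq :=
  amx (label_rel [:: (0, 2); (0, 3); (0, 4); (0, 5); (1, 2); (1, 3); (1, 4);
                     (1, 6); (5, 6)]) [:: 6; 5; 4; 3; 2; 1; 0].

(* Adjacencies to (e, d) of the j remaining vertices, then of s, r, q, p. *)
Definition flags (j : nat) : seq bitseq :=
  nseq j [:: false; false] ++
  [:: [:: true; false]; [:: true; false]; [:: false; true]; [:: false; true]].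

Definition cats (A B : seq (seq nat)) : seq (seq nat) :=
  [seq i ++ j | i <- A, j <- B].

(** Trying only the candidates in [L] spares a search through all labellings. *)
Definition labelled_by (m : nat) (E : seq (nat * nat)) (L : seq (seq nat))
    (M : seq bitseq) : bool :=
  has (fun t => perm_eq t (iota 1 m) && (amx (label_rel E) t == M)) L.

(** * Soundness of the pruning and completeness of the search *)

Lemma amx_cons (G : sgraph) (v : G) (s : seq G) :
  amx (@adj G) (v :: s) = border [seq adj v w | w <- s] (amx (@adj G) s).
Proof.
rewrite /border /amx /= adj_irr; congr (_ :: _).
rewrite zip_map -map_comp; apply: eq_map => u /=.
by rewrite adj_sym.
Qed.

Lemma meet_map (T : Type) (f g : pred T) (s : seq T) :
  meet (map f s) (map g s) = has (fun z => f z && g z) s.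
Proof. by rewrite /meet zip_map has_map. Qed.

(** The equality case detects that all neighbours of [v] already occur in [s]. *)
Lemma count_nbr (G : sgraph) (v : G) (s : seq G) :
  uniq s -> count (adj v) s <= #|nbr v| ?= iff
    (nbr v \subset [seq w <- s | adj v w]).
Proof.
move=> Us; rewrite -size_filter.
have /card_uniqP <- : uniq [seq w <- s | adj v w] by apply: filter_uniq.
by apply: subset_leqif_card; apply/subsetP=> w; rewrite mem_filter inE => /andP[].
Qed.

Lemma mem_bitseqs (s : bitseq) : s \in bitseqs (size s).
Proof.
elim: s => //= b s IH; rewrite mem_cat.
case: b; first by rewrite (map_f (cons true)).
by rewrite cats0 (map_f (cons false)) // orbT.
Qed.

(** A single equation for two conditions: no triangles, and a common neighbour for every
    non-adjacent pair. *)
Definition adj_disjoint (G : sgraph) : Prop :=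
  forall v w : G, adj v w = [disjoint nbr v & nbr w].

Lemma common_nbr (G : sgraph) (v w : G) :
  adj_disjoint G -> ~~ adj v w -> exists2 z, adj v z & adj w z.
Proof.
move=> Gd; rewrite Gd => /pred0Pn[z /andP[]]; rewrite !inE => vz wz.
by exists z.
Qed.

Lemma triangle_free (G : sgraph) (v w z : G) :
  adj_disjoint G -> adj v w -> adj v z -> ~~ adj w z.
Proof.
move=> Gd + vz; rewrite Gd => /pred0P/(_ z) /=.
by rewrite !inE vz /= => ->.
Qed.

Lemma amx_admissible (G : sgraph) (s : seq G) :
  (forall v : G, #|nbr v| = 4) -> adj_disjoint G -> uniq s ->
  admissible (amx (@adj G) s).
Proof.
move=> G4 Gd Us; rewrite /admissible.
have -> : all (fun r => count id r <= 4) (amx (@adj G) s).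
  rewrite /amx all_map; apply/allP=> v _ /=.
  by rewrite count_map /= -(G4 v) count_nbr.
rewrite {2}/amx all_map; apply/allP=> v _ /=.
rewrite zip_map all_map; apply/allP=> w _ /=.
rewrite meet_map; case: ifP => [vw | /negbT vw].
  by apply/hasPn=> z _; apply/negP=> /andP[vz]; apply/negP; apply: triangle_free vz.
(* A full row of [v] puts all of N(v) in [s], so the common neighbour found in [G] is visible in the
   matrix. *)
apply/implyP; rewrite count_map -(G4 v) (count_nbr _ Us) => /subsetP sv.
have [z vz wz] := common_nbr Gd vw; apply/hasP; exists z; last by rewrite vz.
by have := sv z; rewrite inE vz mem_filter => /(_ isT)/andP[].
Qed.

(** No filtering step discards the true matrix: every suffix of the list consists of distinct
    vertices, so its matrix is admissible. *)
Lemma mem_grow (G : sgraph) (x y a b c d e : G) (l : seq G) :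
  (forall v : G, #|nbr v| = 4) -> adj_disjoint G ->
  uniq (l ++ [:: e; d; c; b; a; y; x]) ->
  {in l, forall v, ~~ adj v y && ~~ adj v x} ->
  amx (@adj G) (l ++ [:: e; d; c; b; a; y; x]) \in
    grow (amx (@adj G) [:: e; d; c; b; a; y; x])
         [seq [:: adj v e; adj v d] | v <- l].
Proof.
move=> G4 Gd; elim: l => [|v l IH]; first by rewrite mem_head.
set t0 := [:: e; _; _; _; _; _; _] in IH *; move=> /= Uvl nl.
have /andP[_ Ul] := Uvl.
have /andP[/negbTE vy /negbTE vx] := nl v (mem_head _ _).
apply/flatten_mapP; exists (amx (@adj G) (l ++ t0)).
  by apply: IH => // w lw; apply: nl; rewrite inE lw orbT.
rewrite mem_filter amx_admissible // andTb amx_cons map_cat.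
have -> : [seq adj v w | w <- t0] =
    [:: adj v e; adj v d] ++ [:: adj v c; adj v b; adj v a] ++ [:: false; false].
  by rewrite /t0 /= vy vx.
apply/allpairsP; exists ([seq adj v w | w <- l], [:: adj v c; adj v b; adj v a]).
split => //=; last exact: (mem_bitseqs [:: _; _; _]).
by rewrite size_map size_cat addnK -(size_map (adj v)) mem_bitseqs.
Qed.

(** * From equal matrices to isomorphisms with G1 and G2 *)

Lemma mem_full (T : finType) (s : seq T) :
  uniq s -> size s = #|T| -> forall v, v \in s.
Proof.
move=> Us sT v; have [||_ ->] := uniq_min_size Us (s2 := enum T).
- by move=> w _; rewrite mem_enum.
- by rewrite -cardT sT.
- by rewrite mem_enum.
Qed.

Lemma amx_regular4 (G : sgraph) (s : seq G) :
  (forall v : G, #|nbr v| = 4) -> uniq s -> size s = #|G| ->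
  regular4 (amx (@adj G) s).
Proof.
move=> G4 Us sG; rewrite /regular4 /amx all_map; apply/allP=> v _ /=.
rewrite count_map -(G4 v) (count_nbr _ Us); apply/subsetP=> w.
by rewrite inE mem_filter mem_full // => ->.
Qed.

(** Each entry of [s] is sent to the entry of [t] at the same position; [w0] serves as the default
    of [nth]. *)
Lemma isomorphic_amx (G H : sgraph) (w0 : H) (s : seq G) (t : seq H) :
  uniq s -> size s = #|G| -> uniq t -> size t = #|H| ->
  amx (@adj G) s = amx (@adj H) t -> isomorphic G H.
Proof.
move=> Us sG Ut tH Ast.
have st : size s = size t by have := congr1 size Ast; rewrite !size_map.
have mem_s := mem_full Us sG.
have is_t v : index v s < size t by rewrite -st index_mem.
pose f v := nth w0 t (index v s).
have f_inj : injective f.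
  by move=> v w /eqP; rewrite nth_uniq // => /eqP /index_inj; apply.
exists f => [|v w]; first by apply: inj_card_bij => //; rewrite -sG -tH st.
have := congr1 (fun M => nth false (nth [::] M (index v s)) (index w s)) Ast.
rewrite (nth_map v) ?st // (nth_map w) ?st // (nth_map w0) // (nth_map w0) //.
by rewrite !nth_index.
Qed.

Lemma isomorphic_edge_graph (G : sgraph) (m : nat) (E : seq (nat * nat))
    (L : seq (seq nat)) (s : seq G) :
  uniq s -> size s = #|G| -> labelled_by m.+1 E L (amx (@adj G) s) ->
  isomorphic G (edge_graph m.+1 E).
Proof.
move=> Us sG /hasP[t _ /andP[tm /eqP Ats]].
have rg i : i \in t -> 0 < i <= m.+1.
  by rewrite (perm_mem tm) mem_iota; lia.
have inordE i : i \in t -> (inord i.-1 : 'I_m.+1).+1 = i.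
  by move=> /rg it; rewrite inordK; lia.
pose g i : edge_graph m.+1 E := inord i.-1.
have g_inj : {in t &, injective g}.
  by move=> i j /inordE {2}<- /inordE {2}<- gij; rewrite -[inord _]/(g _) gij.
apply: (@isomorphic_amx _ _ (g 0) s [seq g i | i <- t]) => //.
- by rewrite map_inj_in_uniq // (perm_uniq tm) iota_uniq.
- by rewrite size_map (perm_size tm) size_iota card_ord.
rewrite -Ats /amx -map_comp; apply/eq_in_map => i it /=.
rewrite -map_comp; apply/eq_in_map => j jt /=.
rewrite /label_rel /edge_rel -(inj_in_eq g_inj) //.
by rewrite /g /= !inordE.
Qed.

(* The vertices of the graph in the order (t,) s, r, q, p, e, d, c, b, a, y, x; up
   to permutations of {r, s}, {p, q} and {a, b, c} one choice of labels suffices. *)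
Definition G1_labellings : seq (seq nat) :=
  cats (permutations [:: 10; 7]) (cats (permutations [:: 8; 11])
  (cats [:: [:: 9; 5]] (cats (permutations [:: 2; 3; 4]) [:: [:: 6; 1]]))).

Definition G2_labellings : seq (seq nat) :=
  cats [:: [:: 10]] (cats (permutations [:: 11; 12]) (cats (permutations [:: 8; 9])
  (cats [:: [:: 7; 6]] (cats (permutations [:: 3; 4; 5]) [:: [:: 2; 1]])))).

(** A copy of the list inside [G1], so that [edge_graph 11 G1_edges] is [G1] by conversion. *)
Definition G1_edges :=
  [:: (1, 2); (1, 3); (1, 4); (1, 5); (2, 6); (3, 6); (4, 6); (2, 7); (3, 7);
      (3, 8); (2, 10); (4, 11); (4, 8); (5, 8); (8, 10); (5, 9); (5, 11);
      (6, 9); (7, 9); (7, 11); (9, 10); (10, 11)].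

Definition G2_edges :=
  [:: (1, 3); (1, 4); (1, 5); (1, 6); (2, 3); (2, 4); (2, 5); (2, 7); (6, 7);
      (6, 8); (3, 8); (8, 12); (8, 11); (6, 9); (4, 9); (9, 12); (9, 10);
      (3, 10); (5, 10); (10, 11); (7, 11); (4, 11); (7, 12); (5, 12)].

(** * Evaluation of the search for 11, 12 and 13 vertices *)

Lemma grow11 (M : seq bitseq) : M \in grow core (flags 0) ->
  regular4 M -> labelled_by 11 G1_edges G1_labellings M.
Proof.
have /allP chk : all (labelled_by 11 G1_edges G1_labellings)
    [seq N <- grow core (flags 0) | regular4 N] by vm_cast_no_check (erefl true).
by move=> gM rM; apply: chk; rewrite mem_filter rM.
Qed.

Lemma grow12 (M : seq bitseq) : M \in grow core (flags 1) ->
  regular4 M -> labelled_by 12 G2_edges G2_labellings M.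
Proof.
have /allP chk : all (labelled_by 12 G2_edges G2_labellings)
    [seq N <- grow core (flags 1) | regular4 N] by vm_cast_no_check (erefl true).
by move=> gM rM; apply: chk; rewrite mem_filter rM.
Qed.

Lemma grow13 (M : seq bitseq) : M \in grow core (flags 2) -> ~~ regular4 M.
Proof.
have /allP chk : all (fun N => ~~ regular4 N) (grow core (flags 2))
  by vm_cast_no_check (erefl true).
exact: chk.
Qed.

(** * The surroundings of a non-adjacent pair with three common neighbours *)

Lemma cards3 (T : finType) (A : {set T}) :
  #|A| = 3 -> exists a b c, uniq [:: c; b; a] /\ A =i [:: c; b; a].
Proof.
move=> A3; have := enum_uniq A; have := mem_enum A; have := cardE A.
rewrite A3; case: (enum A) => [|c [|b [|a []]]] //= _ mA UA.
by exists a, b, c; split=> // v; rewrite mA.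
Qed.

Lemma card_nbr_minus2 (G : sgraph) (a x y : G) :
  #|nbr a| = 4 -> x != y -> adj a x -> adj a y -> #|nbr a :\: [set x; y]| = 2.
Proof.
move=> a4 xy ax ay; have := cardsID [set x; y] (nbr a).
rewrite a4 (setIidPr _) ?cards2 ?xy => [[]//|].
by apply/subsetP=> v; rewrite !inE => /orP[]/eqP->.
Qed.

(** Here [j] counts the vertices other than the eleven named x, y, a, b, c, d, e, p, q, r, s; those
    [j] vertices head the list. *)
Lemma exists_labelling (G : sgraph) (x y : G) :
  (forall v : G, #|nbr v| = 4) -> adj_disjoint G ->
  x != y -> ~~ adj x y -> #|nbr x :&: nbr y| = 3 ->
  exists j, exists s : seq G,
    [/\ j <= 2, uniq s, size s = #|G|, size s = j + 11
      & amx (@adj G) s \in grow core (flags j)].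
Proof.
move=> G4 Gd xy nxy /[dup] Cxy /cards3[a [b [c [Uabc memC]]]].
have tf := fun v w z => @triangle_free G v w z Gd.
have sym := @adj_sym G; have irr := @adj_irr G.
have : #|nbr x :\: nbr y| == 1 by have := cardsID (nbr y) (nbr x); rewrite G4; lia.
have : #|nbr y :\: nbr x| == 1.
  by have := cardsID (nbr x) (nbr y); rewrite G4 setIC; lia.
case/cards1P=> e Ee /cards1P[d Ed].
have Nx v : adj x v = (v \in [:: d; c; b; a]).
  have := memC v; have /setP/(_ v) := Ed; rewrite in_cons !inE => <- <-.
  by case: (adj x v); case: (adj y v).
have Ny v : adj y v = (v \in [:: e; c; b; a]).
  have := memC v; have /setP/(_ v) := Ee; rewrite in_cons !inE => <- <-.
  by case: (adj x v); case: (adj y v).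
have /setP/(_ d) := Ed; rewrite !inE eqxx => /andP[nyd xd].
have /setP/(_ e) := Ee; rewrite !inE eqxx => /andP[nxe ye].
have de : adj d e.
  have [z] := common_nbr Gd nxe; rewrite Nx inE => /orP[/eqP->|zabc]; first by rewrite sym.
  have yz : adj y z by rewrite Ny inE zabc orbT.
  by rewrite (negbTE (tf _ _ _ ye yz)).
have xe : x != e by apply: contraNneq nxy => ->; rewrite sym.
have yd : y != d by apply: contraNneq nxy => ->.
have dx : adj d x by rewrite sym.
have ed : adj e d by rewrite sym.
have ey : adj e y by rewrite sym.
have /eqP/cards2P[p [q [pq Epq]]] := card_nbr_minus2 (G4 d) xe dx de.
have /eqP/cards2P[r [s [rs Ers]]] := card_nbr_minus2 (G4 e) yd ey ed.
have Nd v : adj d v = (v \in [:: x; e; p; q]).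
  have /setP/(_ v) := Epq; rewrite !inE orbA => <-.
  by case: eqVneq => [->|_]; rewrite ?dx //; case: eqVneq => [->|_]; rewrite ?de.
have Ne v : adj e v = (v \in [:: y; d; r; s]).
  have /setP/(_ v) := Ers; rewrite !inE orbA => <-.
  by case: eqVneq => [->|_]; rewrite ?ey //; case: eqVneq => [->|_]; rewrite ?ed.
have nFT (u v w : G) : adj w u -> ~~ adj w v -> u != v.
  by move=> wu; apply: contraNneq => <-.
have TnF (u v w : G) : ~~ adj w u -> adj w v -> u != v.
  by move=> wu wv; apply: contraNneq wu => ->.
have /setP/(_ p) := Epq; rewrite !inE eqxx negb_or => /andP[/andP[px pe] dp].
have /setP/(_ q) := Epq; rewrite !inE eqxx orbT negb_or => /andP[/andP[qx qe] dq].
have /setP/(_ r) := Ers; rewrite !inE eqxx negb_or => /andP[/andP[ry rd] er].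
have /setP/(_ s) := Ers; rewrite !inE eqxx orbT negb_or => /andP[/andP[sy sd] es].
have [xa xb xc] : [/\ adj x a, adj x b & adj x c] by rewrite !Nx !inE !eqxx !orbT.
have [ya yb yc] : [/\ adj y a, adj y b & adj y c] by rewrite !Ny !inE !eqxx !orbT.
pose R := [:: s; r; q; p]; pose t0 := [:: e; d; c; b; a; y; x].
have nda := tf _ _ _ xd xa; have ndb := tf _ _ _ xd xb; have ndc := tf _ _ _ xd xc.
have nea := tf _ _ _ ye ya; have neb := tf _ _ _ ye yb; have nec := tf _ _ _ ye yc.
have ndr := tf _ _ _ ed er; have nds := tf _ _ _ ed es.
have ndy := tf _ _ _ ed ey.
have nep := tf _ _ _ de dp; have neq := tf _ _ _ de dq; have nex := tf _ _ _ de dx.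
have [ndd nee] : ~~ adj d d /\ ~~ adj e e by rewrite !irr.
have Ut : uniq (R ++ t0).
  move: Uabc; rewrite /R /t0 /= !inE !negb_or !andbT => /andP[/andP[cb ca] ba].
  rewrite cb ca ba /= -!andbA.
  (* Pairs not covered by a hypothesis are separated by adjacency to d or to e. *)
  do ?[apply/andP; split];
    solve [ by [] | by rewrite eq_sym | apply: (@nFT _ _ d) => // | apply: (@TnF _ _ d) => //
          | apply: (@nFT _ _ e) => // | apply: (@TnF _ _ e) => //].
pose T := enum [predC R ++ t0].
have memT v : v \in T -> v \notin R ++ t0 by rewrite mem_enum.
exists (size T), (T ++ R ++ t0).
have UT : uniq (T ++ R ++ t0).
  rewrite cat_uniq enum_uniq Ut andbT; apply/hasPn=> v vR.
  by apply: contraL vR => /memT.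
have TG : size (T ++ R ++ t0) = #|G|.
  rewrite size_cat -cardE -(card_uniqP Ut) addnC.
  exact: cardC.
have notT v : v \in T -> [/\ adj v x = false, adj v y = false,
                             adj v d = false & adj v e = false].
  move=> /memT; rewrite ![adj v _]sym Nx Ny Nd Ne /R /t0 /= !inE !negb_or.
  by do 10![case/andP=> /negbTE->]; move/negbTE->.
have fl : [seq [:: adj v e; adj v d] | v <- T ++ R] = flags (size T).
  rewrite map_cat /flags; congr (_ ++ _).
    rewrite -(size_map (fun v => [:: adj v e; adj v d])); apply/all_pred1P.
    by rewrite all_map; apply/allP=> v /notT[_ _ /= -> ->].
  rewrite /R /= ![adj _ d]sym ![adj _ e]sym dp dq er es.
  (* As d and e are adjacent, no vertex is adjacent to both. *)
  by rewrite !(negbTE (tf _ _ _ ed _)) // !(negbTE (tf _ _ _ de _)).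
have ct0 : amx (@adj G) t0 = core.
  rewrite !amx_cons /= ![adj _ x]sym ![adj _ y]sym.
  rewrite ed ye xd xa xb xc ya yb yc !(negbTE nea, negbTE neb, negbTE nec).
  rewrite !(negbTE nda, negbTE ndb, negbTE ndc, negbTE nxe, negbTE nyd).
  rewrite [adj y x]sym (negbTE nxy).
  by rewrite (negbTE (tf _ _ _ xc xb)) (negbTE (tf _ _ _ xc xa)) (negbTE (tf _ _ _ xb xa)).
have notTR v : v \in T ++ R -> v \notin t0.
  move=> vTR; move: UT; rewrite catA cat_uniq => /and3P[_ /hasPn nTR _].
  by apply: contraL vTR => /nTR.
have TRN v : v \in T ++ R -> [&& ~~ adj v x, ~~ adj v y & ~~ (adj v d && adj v e)].
  move=> /notTR; rewrite ![adj v _]sym Nx Ny /t0 !inE !negb_or.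
  case/and5P=> -> -> -> -> /and3P[-> _ _].
  by case: (boolP (adj d v)) => // /(tf _ _ _ de).
(* Neighbours shared with x and with y, both outside {a, b, c}, would be d and e, which [TRN] rules
   out. *)
have TRn v : v \in T ++ R -> [|| adj v a, adj v b | adj v c].
  move=> /TRN/and3P[vx vy]; have [z] := common_nbr Gd vx; have [w] := common_nbr Gd vy.
  move=> vw + vz; rewrite Nx Ny !inE.
  by case/or4P=> /eqP E /or4P[] /eqP F; subst; rewrite ?vw ?vz ?orbT.
(* Each of a, b, c has two neighbours besides x and y, so [size T + 4 <= 6]. *)
have T2 : size T <= 2.
  pose N z := nbr z :\: [set x; y].
  have N2 z : adj x z -> adj y z -> #|N z| = 2.
    by move=> xz yz; apply: card_nbr_minus2; rewrite // sym.
  have subN : T ++ R \subset N a :|: N b :|: N c.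
    apply/subsetP=> v vTR; move: (TRn v vTR) (notTR v vTR).
    rewrite /t0 !inE !negb_or ![adj v _]sym; case/or3P=> -> /and5P[_ _ _ _].
    - by case/and3P=> _ -> ->.
    - by case/and3P=> _ -> ->; rewrite orbT.
    - by case/and3P=> _ -> ->; rewrite orbT.
  have := subset_leq_card subN; have /card_uniqP-> : uniq (T ++ R).
    by move: UT; rewrite catA cat_uniq => /andP[].
  move/leq_trans/(_ (leq_card_setU _ _)).
  move/leq_trans/(_ (leq_add (leq_card_setU _ _) (leqnn _))).
  by rewrite !N2 // size_cat (leq_add2r 4 _ 2).
rewrite TG; split => //.
  by rewrite -TG !size_cat /= addnC.
rewrite -ct0 -fl catA; apply: mem_grow => //; first by rewrite -catA.
by move=> v /TRN/and3P[-> ->].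
Qed.

(** * Reduction to k = 4 and to the orders 11 and 12 *)

Theorem mainTheorem1 (n k : nat) (G : sgraph) :
  4 <= k ->
  SQSR n k 0 [:: k - 1; k - 2; k - 3] G ->
  [/\ 2 * k + 3 <= n <= k ^ 2 - 4,
      n = k ^ 2 - 4 <-> isomorphic G G2
    & n = 2 * k + 3 <-> isomorphic G G1].
Proof.
move=> k4 [[[Gn Gk Ga Gc] Ggr] _].
have tf (u v w : G) : adj u v -> adj u w -> ~~ adj v w.
  move=> uv uw; apply/negP=> vw; have /eqP := Ga _ _ vw; rewrite cards_eq0.
  by move/eqP/setP/(_ u); rewrite !inE ![adj _ u]adj_sym uv uw.
have Gc3 (u v : G) : u != v -> ~~ adj u v -> k - 3 <= #|nbr u :&: nbr v|.
  by move=> uv /(Gc _ _ uv); rewrite !inE => /or3P[]/eqP->; lia.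
(* A grade equal to the number of parameters means that each of them is attained. *)
have : attained G (k - 1).
  by move: Ggr; rewrite /grade => /eqP; rewrite -all_count => /andP[].
case/existsP=> x /existsP[y /and3P[xy nxy /eqP Cxy]].
have /eqP/cards1P[d Ed] : #|nbr x :\: nbr y| = 1.
  by have := cardsID (nbr y) (nbr x); rewrite Gk; lia.
have /eqP/cards1P[e Ee] : #|nbr y :\: nbr x| = 1.
  by have := cardsID (nbr x) (nbr y); rewrite Gk setIC; lia.
have /setP/(_ e) := Ee; rewrite !inE eqxx => /andP[nxe ye].
have xe : x != e by apply: contraNneq nxy => ->; rewrite adj_sym.
(* The common neighbours of x and e avoid N(y), so there is at most one. *)
have k4' : k = 4.
  have : nbr x :&: nbr e \subset [set d].
    rewrite -Ed; apply/subsetP=> z; rewrite !inE => /andP[xz ez]; rewrite xz andbT.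
    by apply: contraL ez; apply: tf.
  by move/subset_leq_card; rewrite cards1; have := Gc3 _ _ xe nxe; lia.
subst k; have Gd : adj_disjoint G.
  move=> u v; rewrite -setI_eq0; apply/idP/idP=> [/Ga/eqP|]; first by rewrite cards_eq0.
  (* Distinct non-adjacent vertices share at least [k - 3], here 1, neighbours; equal ones share
     4. *)
  rewrite -cards_eq0; apply: contraLR => uv; rewrite -lt0n.
  have [<-|/Gc3/(_ uv)//] := eqVneq u v; by rewrite setIid Gk.
have [j [s [j2 Us sG sj As]]] := exists_labelling Gk Gd xy nxy Cxy.
have R4 := amx_regular4 Gk Us sG.
have isoE (m : nat) E : isomorphic G (edge_graph m E) -> n = m.
  by case=> f /bij_eq_card; rewrite Gn card_ord.
have nj : n = j + 11 by rewrite -Gn -sG sj.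
(* Now [2 * k + 3] is 11 and [k ^ 2 - 4] is 12, so this dichotomy gives the bounds and, as
   isomorphism preserves the order, both equivalences. *)
suff : n = 11 /\ isomorphic G G1 \/ n = 12 /\ isomorphic G G2.
  by case=> -[nE iG]; rewrite nE in isoE *; split=> //; split=> // /isoE.
case: j j2 As nj {sj} => [|[|[|//]]] _ As ->; [left | right | exfalso]; rewrite ?addn0.
- split; first by [].
  exact: isomorphic_edge_graph Us sG (grow11 As R4).
- split; first by [].
  exact: isomorphic_edge_graph Us sG (grow12 As R4).
- by have := grow13 As; rewrite R4.
Qed.
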